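(* Let $d\ge1$, $q\in(0,\infty]$ and let $U(q,x)$ be as defined in the context. There exists $C_4=C_4(d,q)\in(0,\infty)$ such that for all $x\ge1$ $$U(q,x)\ge \exp\big(-C_4\,x^{\min(q,2)/d}\big).$$
   Context: For $x>0$ and a random variable $\tau$, $T(\tau,x)=\max(\mathbf P(\tau>x),\mathbf P(\tau<-x))$. Let $\{\xi(i,m): i\ge1,\ 1\le m\le d\}$ be mutually independent centered random variables. Let $\mathcal K_d$ be the set of vectors $k\in\{0,1,\dots,d\}^d$ with $\sum_l k(l)=d$; for $k\in\mathcal K_d$ let $l_1<\dots<l_s$ be the indices with $k(l)>0$. A centered polynomial of degree $d$ with diagonal members is $$R_d=\sum_{k\in\mathcal K_d}\ \sum_{1\le j_1<\dots<j_s\le n} b_k(j_1,\dots,j_s)\prod_{r=1}^s\Big(\xi(j_r,l_r)^{k(l_r)}-\mathbf E\,\xi(j_r,l_r)^{k(l_r)}\Big),$$ with $\sum_{k}\sum_j b_k(j)^2=1$. $U(q,x)$ is the supremum of $T(R_d,x)$ over all $n\ge1$, all such normalized coefficients, and all totally independent centered families $\{\xi(i,m)\}$ with $T(\xi(i,m),x)\le \exp(-x^q)$ for all $x\ge0$ and all $i,m$. *)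

(* Defs.v *)
From HB Require Import structures.
From mathcomp Require Import all_boot all_order all_algebra.
From mathcomp Require Import all_classical all_reals all_analysis.
Set Implicit Arguments. Unset Strict Implicit. Unset Printing Implicit Defensive.
Import Order.TTheory GRing.Theory Num.Theory.
Import numFieldNormedType.Exports.
Local Open Scope classical_set_scope.
Local Open Scope ring_scope.

Definition Ttail {dT} {T : measurableType dT} {R : realType}
  (P : probability T R) (tau : T -> R) (x : R) : \bar R :=
  maxe (P [set w | x < tau w]) (P [set w | tau w < - x]).

Definition mutually_independent {dT} {T : measurableType dT} {R : realType}
  (P : probability T R) (I : eqType) (X : I -> T -> R) : Prop :=
  forall (s : seq I) (B : I -> set R), uniq s ->
    (forall i, i \in s -> measurable (B i)) ->
    P (\bigcap_(i in [set i | i \in s]) (X i @^-1` B i)) =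
      (\prod_(i <- s) P (X i @^-1` B i))%E.

Definition centered {dT} {T : measurableType dT} {R : realType}
  (P : probability T R) (X : T -> R) : Prop :=
  P.-integrable setT (EFin \o X) /\ ('E_P[X])%E = 0%E.

(* exp(-x^q) for q in (0, +oo]; for q = +oo we use the pointwise limit
   convention x^oo = +oo (x > 1), so the bound is 0 for x > 1, 1 for x < 1
   (at x = 1 it is taken as 1; by right-continuity of tails this does not
   change the class of variables). *)
Definition tailbound {R : realType} (q : \bar R) (x : R) : R :=
  match q with
  | EFin r => expR (- (x `^ r))
  | +oo%E => if x <= 1 then 1 else 0
  | -oo%E => 1
  end.

Definition minq2 {R : realType} (q : \bar R) : R := fine (mine q 2%:E).

(* Index data of R_d: k in K_d is a map 'I_d -> {0..d} with sum d;
   for such k, the tuple j_1 < ... < j_s (indices in {0..n-1}, shifted from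
   {1..n}) attached to l_1 < ... < l_s (the l with k l > 0) is encoded as
   J : 'I_d -> option 'I_n with J l = Some j_r at l = l_r and None off the
   support of k. *)
Definition admissible (d n : nat) (k : {ffun 'I_d -> 'I_d.+1})
  (J : {ffun 'I_d -> option 'I_n}) : bool :=
  [&& (\sum_(l < d) (k l : nat) == d)%N,
      [forall l : 'I_d, (k l != ord0) == (J l != None)] &
      [forall l : 'I_d, forall l' : 'I_d, (l < l')%N ==>
         match J l, J l' with
         | Some j, Some j' => (j < j')%N
         | _, _ => true
         end]].

Definition Rpoly {dT} {T : measurableType dT} {R : realType}
  (P : probability T R) (d n : nat) (xi : nat -> 'I_d -> T -> R)
  (b : {ffun 'I_d -> 'I_d.+1} -> {ffun 'I_d -> option 'I_n} -> R)
  : T -> R := fun w =>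
  \sum_(k : {ffun 'I_d -> 'I_d.+1})
   \sum_(J : {ffun 'I_d -> option 'I_n} | admissible k J)
     b k J * \prod_(l < d | k l != ord0)
       match J l with
       | Some j => xi j l w ^+ k l - fine (('E_P[fun v => (xi j l v ^+ k l)%R])%E)
       | None => 1
       end.

Definition Ufun {R : realType} (d : nat) (q : \bar R) (x : R) : \bar R :=
  ereal_sup [set t : \bar R |
    exists (n : nat) (dT : measure_display) (T : measurableType dT)
      (P : probability T R) (xi : nat -> 'I_d -> {RV P >-> R})
      (b : {ffun 'I_d -> 'I_d.+1} -> {ffun 'I_d -> option 'I_n} -> R),
      (1 <= n)%N /\ [/\
        \sum_(k : {ffun 'I_d -> 'I_d.+1})
          \sum_(J : {ffun 'I_d -> option 'I_n} | admissible k J) b k J ^+ 2 = 1,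
        mutually_independent P (fun im : nat * 'I_d => (xi im.1 im.2 : T -> R)),
        (forall i m, centered P (xi i m)),
        (forall i m (y : R), 0 <= y -> (Ttail P (xi i m) y <= (tailbound q y)%:E)%E) &
        t = Ttail P (Rpoly P (fun i m => (xi i m : T -> R)) b) x]].

(* Main.v *)
Require Import Defs.
From HB Require Import structures.
From mathcomp Require Import all_boot all_order all_algebra.
From mathcomp Require Import all_classical all_reals all_analysis.
From mathcomp Require Import ring lra.
Import Order.TTheory GRing.Theory Num.Theory.
Local Open Scope classical_set_scope.
Local Open Scope ring_scope.

(** Take independent variables equal to [a] and [-a] with probability [p] each
    and to [0] otherwise, and the product over [l < d] of the normalized sums
    [N ^ (-1/2) * sum_j xi(j, l)], with [j] in the [l]-th block of [N] indices:
    it is one of the polynomials [R_d]. When all the variables equal [a], an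
    event of probability at least [p ^ (d * N * d)], its value is
    [(sqrt N * a) ^ d]. For [q <= 2] one takes a single variable per block
    ([N = 1]) with [a] of order [x ^ (1/d)] and [p] of order [exp (- a ^ q)];
    for [q > 2] one takes [a = p = 1/2] and [N] of order [x ^ (2/d)]. *)

(** * Finite product space of independent three-valued outcomes *)

Definition outcomes (I : finType) : Type := {ffun I -> option bool}.
HB.instance Definition _ (I : finType) := Finite.on (outcomes I).
HB.instance Definition _ (I : finType) :=
  isPointed.Build (outcomes I) [ffun=> None].
HB.instance Definition _ (I : finType) :=
  @isMeasurable.Build default_measure_display (outcomes I)
    discrete_measurable discrete_measurable0
    discrete_measurableC discrete_measurableU.

Section iid_signs.
Context {R : realType} {I : finType} {p : R}.
Hypotheses (p_ge0 : 0 <= p) (p_le : p <= 2^-1).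

Definition law (o : option bool) : R := if o is Some _ then p else 1 - p *+ 2.

Lemma sum_option_bool (g : option bool -> R) :
  \sum_o g o = g None + (g (Some true) + g (Some false)).
Proof.
rewrite (bigD1 None)//= (bigD1 (Some true))//= (bigD1 (Some false))//=.
by rewrite big1 ?addr0// => -[[]|].
Qed.

Lemma sum_law : \sum_o law o = 1.
Proof. by rewrite sum_option_bool /=; ring. Qed.

Lemma law_ge0 o : 0 <= law o.
Proof. by case: o => //=; rewrite mulr2n; move: p_le; lra. Qed.

Definition weight (w : outcomes I) : R := \prod_i law (w i).

Lemma weight_ge0 w : 0 <= weight w.
Proof. by apply: prodr_ge0 => i _; exact: law_ge0. Qed.

Definition mean (f : outcomes I -> R) : R := \sum_w weight w * f w.

Lemma mean_prod (g : I -> option bool -> R) :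
  mean (fun w => \prod_i g i (w i)) = \prod_i \sum_o law o * g i o.
Proof.
rewrite bigA_distr_bigA/=; apply: eq_bigr => w _.
by rewrite /weight -big_split.
Qed.

Lemma meanZ k f : mean (fun w => k * f w) = k * mean f.
Proof. by rewrite /mean mulr_sumr; apply: eq_bigr => w _; rewrite mulrCA. Qed.

Lemma mean_cst k : mean (fun=> k) = k.
Proof.
transitivity (mean (fun=> k * \prod_(i : I) 1)).
  by apply: eq_bigr => w _; rewrite big1_eq mulr1.
rewrite meanZ (mean_prod (fun _ _ => 1)) big1 ?mulr1// => i _.
by under eq_bigr do rewrite mulr1; exact: sum_law.
Qed.

(** Writing the law as a finite sum of weighted Dirac masses makes it a measure by construction.
    [msum] is indexed by naturals, so outcomes are enumerated; the default [point] is never reached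
    below the cardinal. *)
Definition iid : set (outcomes I) -> \bar R :=
  let w_ k := nth point (enum {: outcomes I}) k in
  msum (fun k => mscale (NngNum (weight_ge0 (w_ k))) (dirac (w_ k)))
    #|{: outcomes I}|.

HB.instance Definition _ := Measure.on iid.

Lemma iidE A : iid A = (mean \1_A)%:E.
Proof.
rewrite /iid /msum /mscale /mean.
rewrite (eq_bigr (fun k : 'I__ => (weight (enum_val k) *
  \1_A (enum_val k))%:E)) => [|k _]; last first.
  rewrite EFinM (enum_val_nth (point : outcomes I)).
  congr (_ * _)%E; exact: diracE.
rewrite sumEFin; congr EFin.
by rewrite [RHS](reindex_onto (@enum_val _ _) enum_rank)/= => [|w _];
  rewrite ?enum_rankK// ; apply: eq_bigl => k; rewrite enum_valK eqxx.
Qed.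

Lemma iid_setT : iid setT = 1%E.
Proof. by rewrite iidE indicT [mean _]mean_cst. Qed.

HB.instance Definition _ := Measure_isProbability.Build _ _ _ iid iid_setT.

Lemma measurable_outcomes (f : outcomes I -> R) : measurable_fun setT f.
Proof. by []. Qed.

(** Decomposition into indicators of singletons, which reduces integrability and expectation to the
    indicator case. *)
Lemma outcomesE (f : outcomes I -> R) :
  EFin \o f = (fun w => (\sum_v (f v)%:E * (\1_[set v] w)%:E)%E).
Proof.
apply/funext => w /=; rewrite (bigD1 w)//= indicE mem_set// mule1.
rewrite big1 ?adde0// => v vw; rewrite indicE memNset ?mule0//= => wv.
by rewrite wv eqxx in vw.
Qed.

Lemma iid_integrable (f : outcomes I -> R) : iid.-integrable setT (EFin \o f).
Proof.
rewrite outcomesE; apply: integrable_sum => // v _.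
by apply: integrableZl => //; exact: integrable_indic.
Qed.

Lemma iid_expectation (f : outcomes I -> R) : ('E_iid[f])%E = (mean f)%:E.
Proof.
rewrite unlock; transitivity (\int[iid]_w ((EFin \o f) w))%E => //.
rewrite outcomesE integral_sum//=; last first.
  by move=> v; apply: integrableZl => //; exact: integrable_indic.
rewrite /mean -sumEFin; apply: eq_bigr => v _.
rewrite integralZl//=; last exact: integrable_indic.
rewrite integral_indic// setIT [X in (_ * X)%E]iidE -EFinM; congr EFin.
rewrite mulrC; congr (_ * _); rewrite /mean (bigD1 v)//= indicE mem_set// mulr1.
by rewrite big1 ?addr0// => w wv; rewrite indicE memNset ?mulr0//=; exact/eqP.
Qed.

(** * Independence of variables that read distinct coordinates *)

Section coordinates.
Context {J : eqType} (c : J -> option I) (v : option bool -> R).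
Hypothesis c_inj : forall j j' i, c j = Some i -> c j' = Some i -> j = j'.

(** An infinite family lives on a finite space: an index that [c] sends to [None] gives the constant
    0. *)
Definition coordinate (j : J) (w : outcomes I) : R :=
  if c j is Some i then v (w i) else 0.

(** [k] and [G] split a function of one variable into a constant times a product over all sites [i],
    the form to which [mean_prod] applies. *)
Let k (g : R -> R) j : R := if c j is Some _ then 1 else g 0.
Let G (g : R -> R) i j o : R := if c j == Some i then g (v o) else 1.

Let coordinateE g j w :
  g (coordinate j w) = k g j * \prod_i G g i j (w i).
Proof.
rewrite /coordinate /k /G; case: (c j) => [i|]; last first.
  by rewrite big1_eq mulr1.
rewrite mul1r (bigD1 i)//= eqxx [X in _ * X]big1 ?mulr1// => i' ii'.
by case: ifPn => // /eqP[ii'E]; rewrite ii'E eqxx in ii'.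
Qed.

Let mean_coordinateE g j : mean (fun w => g (coordinate j w)) =
  k g j * \prod_i \sum_o law o * G g i j o.
Proof.
by rewrite -mean_prod -meanZ; apply: eq_bigr => w _; rewrite coordinateE.
Qed.

Let sum_law_G g i j : c j <> Some i -> \sum_o law o * G g i j o = 1.
Proof.
move=> /eqP/negPf cj; rewrite -sum_law; apply: eq_bigr => o _.
by rewrite /G cj mulr1.
Qed.

(** After factorization both sides are products over sites. By [c_inj] each site is read by at most
    one [j], so there the sum of the product is the product of the sums. *)
Lemma mean_prod_coordinate (s : seq J) (g : J -> R -> R) : uniq s ->
  mean (fun w => \prod_(j <- s) g j (coordinate j w)) =
  \prod_(j <- s) mean (fun w => g j (coordinate j w)).
Proof.
move=> us; rewrite (eq_bigr _ (fun j _ => mean_coordinateE (g j) j)).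
transitivity (\prod_(j <- s) k (g j) j *
    \prod_i \sum_o law o * \prod_(j <- s) G (g j) i j o).
  rewrite -mean_prod -meanZ; apply: eq_bigr => w _; congr (_ * _).
  by rewrite exchange_big -big_split/=; apply: eq_bigr => j _; exact: coordinateE.
rewrite [in RHS]big_split/= [in RHS]exchange_big/=; congr (_ * _).
apply: eq_bigr => i _.
(* Either a single [j] of [s] reads site [i] and all other factors are 1, or none does and both
   sides are 1. *)
have [/hasP[j js /eqP cj]|/hasPn cs] := boolP (has (fun j => c j == Some i) s).
  have cj' j' : j' != j -> c j' <> Some i.
    by move=> /eqP + cj'; apply; exact: c_inj cj' cj.
  rewrite [RHS](bigD1_seq j)//= [X in _ = _ * X]big1 ?mulr1; last first.
    by move=> j' /cj'; exact: sum_law_G.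
  apply: eq_bigr => o _; rewrite (bigD1_seq j)//= big1 ?mulr1// => j' /cj'.
  by rewrite /G => /eqP/negPf ->.
rewrite [RHS]big_seq [RHS]big1 => [|j /cs/eqP]; last exact: sum_law_G.
rewrite -[RHS]sum_law; apply: eq_bigr => o _; rewrite big_seq.
rewrite big1 ?mulr1// => j /cs.
by rewrite /G => /negPf ->.
Qed.

Lemma mean_coordinate j i g : c j = Some i ->
  mean (fun w => g (coordinate j w)) = \sum_o law o * g (v o).
Proof.
move=> cj; transitivity (mean (fun w => \prod_i' G g i' j (w i'))).
  apply: eq_bigr => w _; rewrite coordinateE /k cj mul1r//.
rewrite (mean_prod (fun i' => G g i' j)) (bigD1 i)//= /G cj eqxx.
rewrite [X in _ * X]big1 ?mulr1// => i' ii'; rewrite -[RHS]sum_law; apply: eq_bigr => o _.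
by case: eqP => [[ii'E]|_]; [rewrite ii'E eqxx in ii'|rewrite mulr1].
Qed.

Lemma coordinate_independent : mutually_independent iid coordinate.
Proof.
move=> s B us mB; rewrite [LHS]iidE.
rewrite (eq_bigr _ (fun j _ => iidE (coordinate j @^-1` B j))) prodEFin.
congr EFin.
(* The indicator of an intersection is the product of the indicators. *)
transitivity (mean (fun w => \prod_(j <- s) \1_(B j) (coordinate j w))).
  apply: eq_bigr => w _; congr (_ * _); rewrite indicE.
  have [/allP sB|/allPn[j js jB]] :=
      boolP (all (fun j => coordinate j w \in B j) s).
    rewrite mem_set => [|j /= /sB]; last by rewrite inE.
    by rewrite big_seq big1// => j /sB; rewrite indicE => ->.
  rewrite memNset; last by move=> /(_ _ js); move/negP: jB; rewrite inE.
  by rewrite (bigD1_seq j)//= indicE (negPf jB) mul0r.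
exact: (mean_prod_coordinate _ (fun j => \1_(B j)) us).
Qed.

HB.instance Definition _ j :=
  isMeasurableFun.Build _ _ _ _ (coordinate j) (measurable_outcomes _).

End coordinates.
End iid_signs.

(** * The product of normalized block sums as a polynomial [Rpoly] *)

Lemma sum_block (R : realType) (d N : nat) (l : 'I_d) (c : R) :
  \sum_(j < d * N | (l * N <= j < l.+1 * N)%N) c = c *+ N.
Proof.
rewrite -(big_mkord (fun j => l * N <= j < l.+1 * N)%N (fun=> c)).
under eq_bigl do rewrite andbC.
rewrite -(big_nat_widenl _ _ _ (fun j => (j < l.+1 * N)%N))//.
rewrite -(big_nat_widen _ _ _ xpredT) ?leq_mul2r ?ltn_ord ?orbT//.
by rewrite sumr_const_nat -mulnBl subSnn mul1n.
Qed.

Lemma sum_option (R : realType) (T : finType) (F : option T -> R) :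
  F None = 0 -> \sum_o F o = \sum_x F (Some x).
Proof.
move=> F0; rewrite (bigID isSome)/= [X in _ + X]big1 ?addr0; last by case.
rewrite (reindex_omap Some id)/=; last by case.
by apply: eq_bigl => x; rewrite eqxx.
Qed.

Section block_polynomial.
Context {R : realType} {d : nat} (N : nat).
Hypothesis N_gt0 : (0 < N)%N.

Definition block_weight (l : 'I_d) (o : option 'I_(d * N)) : R :=
  if o is Some j then
    if (l * N <= j < l.+1 * N)%N then (Num.sqrt N%:R)^-1 else 0
  else 0.

Definition ones : {ffun 'I_d -> 'I_d.+1} := [ffun=> inord 1].

Definition block_coef (k : {ffun 'I_d -> 'I_d.+1})
    (J : {ffun 'I_d -> option 'I_(d * N)}) : R :=
  if k == ones then \prod_(l < d) block_weight l (J l) else 0.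

Lemma onesE l : ones l = 1%N :> nat.
(* The existence of [l : 'I_d] forces [0 < d], so [inord 1] does not fall back to its default. *)
Proof. by rewrite ffunE inordK// ltnS; case: d l => [[]|]. Qed.

Lemma ones_neq0 l : ones l != ord0.
Proof. by rewrite -val_eqE/= onesE. Qed.

(** A nonzero product puts each [J l] in the [l]-th block, and the blocks are consecutive, so the
    chosen indices increase. *)
Lemma block_weight_admissible (J : {ffun 'I_d -> option 'I_(d * N)}) :
  ~~ admissible ones J -> \prod_(l < d) block_weight l (J l) = 0.
Proof.
apply: contraNeq => /prodf_neq0 J0; apply/and3P; split.
- by under eq_bigr do rewrite onesE; rewrite sum1_card card_ord.
- apply/forallP => l; rewrite ones_neq0 eq_sym eqb_id.
  by move: (J0 l isT); rewrite /block_weight; case: (J l); rewrite ?eqxx.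
- apply/forallP => l; apply/forallP => l'; apply/implyP => ll'.
  move: (J0 l isT) (J0 l' isT); rewrite /block_weight.
  case: (J l) => [j|//]; case: (J l') => [j'|//].
  case: ifPn => [/andP[_ jl] _|]; last by rewrite eqxx.
  case: ifPn => [/andP[j'l' _] _|]; last by rewrite eqxx.
  by apply: leq_trans jl (leq_trans _ j'l'); rewrite leq_mul2r ll' orbT.
Qed.

(** Inadmissible [J] have weight 0, so the sum extends to all [J] and factors by distributivity. *)
Lemma sum_block_coef (f : 'I_d -> option 'I_(d * N) -> R) :
  \sum_(J | admissible ones J) \prod_(l < d) (block_weight l (J l) * f l (J l)) =
  \prod_(l < d) \sum_(j < d * N | (l * N <= j < l.+1 * N)%N)
    ((Num.sqrt N%:R)^-1 * f l (Some j)).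
Proof.
rewrite big_mkcond/=.
transitivity (\sum_(J : {ffun 'I_d -> option 'I_(d * N)})
    \prod_(l < d) (block_weight l (J l) * f l (J l))).
  apply: eq_bigr => J _; case: ifPn => // /block_weight_admissible J0.
  by rewrite big_split/= J0 mul0r.
rewrite -(bigA_distr_bigA (fun l o => block_weight l o * f l o)).
apply: eq_bigr => l _; rewrite sum_option/= ?mul0r//.
by rewrite [RHS]big_mkcond/=; apply: eq_bigr => j _; case: ifP; rewrite ?mul0r.
Qed.

Lemma block_coef_normalized :
  \sum_(k : {ffun 'I_d -> 'I_d.+1})
    \sum_(J : {ffun 'I_d -> option 'I_(d * N)} | admissible k J)
      block_coef k J ^+ 2 = 1.
Proof.
rewrite (bigD1 ones)//= [X in _ + X]big1 ?addr0 => [|k /negPf k1]; last first.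
  by rewrite big1// => J _; rewrite /block_coef k1 expr0n.
under eq_bigr do rewrite /block_coef eqxx expr2 -big_split/=.
(* Taking [f] to be the weight itself, each block contributes [N] terms equal to [1 / N]. *)
rewrite (sum_block_coef block_weight) big1// => l _.
rewrite (eq_bigr (fun=> (N%:R)^-1)) => [|j jl]; last first.
  by rewrite /= jl -invfM -expr2 sqr_sqrtr.
by rewrite sum_block -[LHS]mulr_natr mulVf// pnatr_eq0 -lt0n.
Qed.

(** Only [k = ones] survives; all exponents are then 1 and the subtracted expectations vanish. *)
Lemma Rpoly_block dT (T : measurableType dT) (P : probability T R)
    (xi : nat -> 'I_d -> T -> R) :
  (forall i m, ('E_P[xi i m])%E = 0%E) ->
  Rpoly P xi block_coef = (fun w => \prod_(l < d)
    \sum_(j < d * N | (l * N <= j < l.+1 * N)%N) (Num.sqrt N%:R)^-1 * xi j l w).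
Proof.
move=> xi0; apply/funext => w; rewrite /Rpoly.
rewrite (bigD1 ones)//= [X in _ + X]big1 ?addr0 => [|k /negPf k1]; last first.
  by rewrite big1// => J _; rewrite /block_coef k1 mul0r.
rewrite -(sum_block_coef (fun l o => if o is Some j then xi j l w else 1)).
apply: eq_bigr => J _; rewrite /block_coef eqxx big_split/=; congr (_ * _).
rewrite big_mkcond/=; apply: eq_bigr => l _; rewrite ones_neq0.
case: (J l) => // j; rewrite onesE expr1.
rewrite (_ : (fun v => _) = xi j l) ?xi0 ?subr0//.
Qed.

End block_polynomial.

(** * Lower bound for [Ufun] with free parameters [a], [p], [N] *)

Lemma tailbound_ge0 (R : realType) (q : \bar R) (y : R) : 0 <= tailbound q y.
Proof. by case: q => [r||] /=; rewrite ?expR_ge0 ?ler01//; case: ifP. Qed.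

Lemma indic_pred (R : realType) (b : pred R) (r : R) :
  \1_[set t | b t] r = (b r)%:R :> R.
Proof.
by rewrite indicE; congr (nat_of_bool _)%:R; apply/idP/idP; rewrite inE.
Qed.

Section Ufun_lower_bound.
Context {R : realType} {d N : nat} {q : \bar R} {a p : R}.
Hypotheses (d_gt0 : (0 < d)%N) (N_gt0 : (0 < N)%N) (a_gt0 : 0 < a).
Hypotheses (p_ge0 : 0 <= p) (p_le : p <= 2^-1).
Hypothesis p_tail : forall y : R, 0 <= y < a -> p <= tailbound q y.

Let I : finType := ('I_(d * N) * 'I_d)%type.
Let P : probability (outcomes I) R := iid p_ge0 p_le.

(* [xi i m] is a constant outside of the finitely many indices that the
   polynomial uses. *)
Let index (im : nat * 'I_d) : option I := omap (pair^~ im.2) (insub im.1).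
Let value (o : option bool) : R :=
  if o is Some b then if b then a else - a else 0.
Let xi (i : nat) (m : 'I_d) : {RV P >-> R} := coordinate index value (i, m).

Let index_inj im im' j : index im = Some j -> index im' = Some j -> im = im'.
Proof.
case: im im' => [i m] [i' m']; rewrite /index/=.
by case: insubP => //= k _ <- [<-]; case: insubP => //= k' _ <- [-> ->].
Qed.

Let mean_xi i m g : mean (p := p) (fun w => g (xi i m w)) =
  if (i < d * N)%N then (1 - p *+ 2) * g 0 + (p * g a + p * g (- a)) else g 0.
Proof.
case: ifPn => idN.
  have im : index (i, m) = Some (Ordinal idN, m) by rewrite /index/= insubT.
  by rewrite (mean_coordinate index value _ _ g im) sum_option_bool.
rewrite -[RHS](mean_cst (I := I) (p := p)); apply: eq_bigr => w _.
by rewrite /xi/= /coordinate /index/= insubF//; exact/negbTE.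
Qed.

Let xi_expectation i m : ('E_P[xi i m])%E = 0%E.
Proof.
rewrite iid_expectation (mean_xi i m id); congr EFin.
by case: ifP => // _; ring.
Qed.

(** The values are [a], [- a] and 0, so each tail is at most [p] for [y < a] and vanishes from [a]
    on; [p_tail] covers the first range. *)
Let xi_tail i m (y : R) : 0 <= y -> (Ttail P (xi i m) y <= (tailbound q y)%:E)%E.
Proof.
move=> y0; have ya : p * (y < a)%R%:R <= tailbound q y.
  case: ltP => ya; last by rewrite mulr0 tailbound_ge0.
  by rewrite mulr1 p_tail// y0.
rewrite /Ttail ge_max; apply/andP; split.
- rewrite [leLHS]iidE lee_fin (mean_xi i m (\1_[set r | y < r])).
  rewrite !(indic_pred _ (fun r => y < r)) ltNge y0/=.
  have -> : (y < - a) = false.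
    by apply/negbTE; rewrite -leNgt (le_trans _ y0)// oppr_le0 ltW.
  by case: ifP => _; rewrite ?tailbound_ge0// !mulr0 add0r addr0.
- rewrite [leLHS]iidE lee_fin (mean_xi i m (\1_[set r | r < - y])).
  rewrite !(indic_pred _ (fun r => r < - y)) oppr_gt0 ltNge y0/= ltrN2.
  have -> : (a < - y) = false.
    by apply/negbTE; rewrite -leNgt (le_trans _ (ltW a_gt0))// oppr_le0.
  by case: ifP => _; rewrite ?tailbound_ge0// !mulr0 !add0r.
Qed.

Lemma Ufun_ge x : x < (Num.sqrt N%:R * a) ^+ d ->
  ((p ^+ (d * N * d))%:E <= Ufun d q x)%E.
Proof.
move=> xa.
pose R_ := Rpoly P (fun i m => (xi i m : outcomes I -> R)) (block_coef N).
apply: (@le_trans _ _ (Ttail P R_ x)); last first.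
  apply: ereal_sup_ubound; exists (d * N)%N, _, _, P, xi, (block_coef N).
  split; first by rewrite muln_gt0 d_gt0.
  split => //.
  - exact: block_coef_normalized.
  - have := coordinate_independent p_ge0 p_le index value index_inj.
    by congr (mutually_independent P _); apply/funext => -[].
  - by move=> i m; split; [exact: iid_integrable|exact: xi_expectation].
rewrite /Ttail le_max; apply/orP; left.
rewrite [leRHS]iidE lee_fin /mean.
(* This single outcome has mass [p ^ (d * N * d)], one factor per element of [I]. *)
pose w0 : outcomes I := [ffun=> Some true].
have w0x : x < R_ w0.
  rewrite /R_ Rpoly_block; last exact: xi_expectation.
  rewrite (eq_bigr (fun=> Num.sqrt N%:R * a)) ?prodr_const ?card_ord// => l _.
  rewrite (eq_bigr (fun=> (Num.sqrt N%:R)^-1 * a)) => [|j _]; last first.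
    by rewrite /xi/= /coordinate /index/= valK/= ffunE.
  (* Each block sum is [N] times [a / sqrt N], that is [sqrt N * a]. *)
  rewrite sum_block -mulrnAl; congr (_ * _).
  rewrite -[LHS]mulr_natr -[X in _ * X](@sqr_sqrtr R)// expr2 mulrA mulVf ?mul1r//.
  by rewrite gt_eqF// sqrtr_gt0 ltr0n.
rewrite (bigD1 w0)//= indicE mem_set// mulr1 -[leLHS]addr0 lerD//; last first.
  by apply: sumr_ge0 => w _; rewrite mulr_ge0 ?weight_ge0.
rewrite /weight (eq_bigr (fun=> p)) => [|i _]; last by rewrite ffunE.
by rewrite prodr_const cardT -cardE card_prod !card_ord.
Qed.

End Ufun_lower_bound.

(** * Choice of the parameters in the two regimes of [q] *)

Section tail_regimes.
Context {R : realType}.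
Implicit Types (d : nat) (x r : R).

Lemma powR_ge1 x r : 1 <= x -> 0 <= r -> 1 <= x `^ r.
Proof. by move=> x1 r0; rewrite -[leLHS](powRr0 x); exact: ler_powR. Qed.

Lemma powR_invnK d x : (0 < d)%N -> 0 <= x -> (x `^ d%:R^-1) ^+ d = x.
Proof.
move=> d0 x0; rewrite -powR_mulrn ?powR_ge0// -powRrM mulVf ?powRr1//.
by rewrite pnatr_eq0 -lt0n.
Qed.

Lemma expRN1_le_half : expR (-1) <= 2^-1 :> R.
Proof.
by rewrite expRN lef_pV2 ?posrE ?expR_gt0// (le_trans _ (expR_ge1Dx 1)).
Qed.

Lemma Ufun_ge_stretched_exp d r x : (0 < d)%N -> 0 < r -> 1 <= x ->
  ((expR (- (((2 `^ r + 1) * (d * d)%:R) * x `^ (r / d%:R))))%:E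
    <= Ufun d r%:E x)%E.
Proof.
move=> d0 r0 x1; have x0 : 0 <= x by exact: le_trans x1.
(* The factor 2 makes [a ^ d = 2 ^ d * x] strictly exceed [x]; the added 1 in the exponent of [p]
   gives [p <= 1 / e <= 1 / 2]. *)
pose a := 2 * x `^ d%:R^-1; pose p := expR (- (a `^ r + 1)).
have a0 : 0 < a by rewrite mulr_gt0// powR_gt0// (lt_le_trans _ x1).
have pe : p <= expR (-1) by rewrite ler_expR lerN2 lerDr powR_ge0.
apply: le_trans (@Ufun_ge R d 1 r%:E a p d0 isT a0 (expR_ge0 _)
  (le_trans pe expRN1_le_half) _ x _); last 2 first.
- move=> y /andP[y0 ya]; rewrite /= ler_expR lerN2.
  rewrite (@le_trans _ _ (a `^ r)) ?lerDl//.
  by apply: ge0_ler_powR; rewrite ?nnegrE//; exact: ltW.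
- rewrite sqrtr1 mul1r exprMn powR_invnK// ltr_pMl ?(lt_le_trans _ x1)//.
  by rewrite exprn_egt1 ?ltr1n// -lt0n.
rewrite lee_fin muln1 -expRM_natl ler_expR mulrN lerN2 [leRHS]mulrAC mulrC.
(* The added 1 is absorbed through [1 <= x ^ (r / d)]. *)
apply: ler_wpM2r => //; rewrite mulrDl mul1r powRM ?powR_ge0// -powRrM.
by rewrite [_ * r]mulrC lerD2l powR_ge1// divr_ge0// ltW.
Qed.

(** For finite [q = r >= 1] and [y < 1 / 2], [exp (- y ^ r) >= 1 - y ^ r >= 1 - y >= 1 / 2]; for
    infinite [q] the bound is 1 there. *)
Lemma half_le_tailbound (q : \bar R) (y : R) : (1%:E <= q)%E ->
  0 <= y < 2^-1 -> 2^-1 <= tailbound q y.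
Proof.
move=> q1 /andP[y0 y2]; case: q q1 => [r||]//=; last first.
  by move=> _; rewrite ifT; [|move: y2]; lra.
rewrite lee_fin => r1; apply: le_trans (expR_ge1Dx _).
have : y `^ r <= y; last by move: y2; lra.
move: y0; rewrite le_eqVlt => /predU1P[<-|y0].
  by rewrite powR0// gt_eqF// (lt_le_trans _ r1).
by apply: ge1r_powR => //; rewrite y0; move: y2; lra.
Qed.

Lemma Ufun_ge_gaussian d (q : \bar R) x : (0 < d)%N -> (1%:E <= q)%E -> 1 <= x ->
  ((expR (- ((5 * (d * d)%:R) * x `^ (2 / d%:R))))%:E <= Ufun d q x)%E.
Proof.
move=> d0 q1 x1; have x0 : 0 <= x by exact: le_trans x1.
pose t := x `^ (2 / d%:R); have t1 : 1 <= t by rewrite powR_ge1// divr_ge0.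
(* [N > 4 * t] yields [sqrt N / 2 > x ^ (1 / d)], while [N <= 4 * t + 1 <= 5 * t] gives the constant
   5. *)
pose N := (Num.trunc (4 * t)).+1.
have /andP[Nlt ltN] : (Num.trunc (4 * t))%:R <= 4 * t < N%:R.
  by apply: truncn_itv; apply: mulr_ge0 => //; exact: le_trans t1.
have half0 : 0 < 2^-1 :> R by rewrite invr_gt0.
apply: le_trans (@Ufun_ge R d N q 2^-1 2^-1 d0 isT half0 (ltW half0) (lexx _)
  (fun y => half_le_tailbound q y q1) x _); last first.
  rewrite -[ltLHS](powR_invnK d x d0 x0) ltr_pXn2r ?nnegrE ?powR_ge0//.
  rewrite ltr_pdivlMr// -[ltLHS]ger0_norm ?mulr_ge0 ?powR_ge0//.
  rewrite -sqrtr_sqr ltr_sqrt ?ltr0n// exprMn -(powR_mulrn 2) ?powR_ge0//.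
  by rewrite -powRrM [_ * 2]mulrC -/t mulrC expr2 -natrM.
(* Replacing [1 / 2] by the smaller [1 / e] turns the power into [exp (- d * N * d)]. *)
rewrite lee_fin; apply: (@le_trans _ _ (expR (-1) ^+ (d * N * d))); last first.
  by rewrite lerXn2r ?nnegrE ?expR_ge0 ?expRN1_le_half ?ltW.
rewrite -expRM_natl mulrN1 ler_expR lerN2 -/t mulnAC natrM mulrC.
rewrite [leRHS]mulrAC [leRHS]mulrC [leRHS]mulrC; apply: ler_wpM2r => //.
by rewrite /N -natr1; move: Nlt t1; lra.
Qed.

End tail_regimes.

Theorem theorem3 (R : realType) (d : nat) (q : \bar R) :
  (1 <= d)%N -> (0 < q)%E ->
  exists C4 : R, 0 < C4 /\
    forall x : R, 1 <= x ->
      ((expR (- (C4 * x `^ (minq2 q / d%:R))))%:E <= Ufun d q x)%E.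
Proof.
move=> d0 q0; have dd : 0 < (d * d)%:R :> R by rewrite ltr0n muln_gt0 d0.
have [q2|q2] := leP q 2%:E.
  (* Both infinite values are excluded by [0 < q <= 2]. *)
  case: q q0 q2 => [r||]//; rewrite lte_fin lee_fin => r0 r2.
  rewrite /minq2 min_l ?lee_fin//=.
  exists ((2 `^ r + 1) * (d * d)%:R); split.
    by rewrite mulr_gt0// ltr_wpDl// powR_ge0.
  by move=> x; exact: Ufun_ge_stretched_exp.
rewrite /minq2 min_r ?(ltW q2)//=; exists (5 * (d * d)%:R).
split=> [|x]; first by rewrite mulr_gt0.
by apply: Ufun_ge_gaussian => //; apply: le_trans (ltW q2); rewrite lee_fin ler1n.
Qed.
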